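(* For $m\in\mathbb{N}$ let $\mu^{(m)}$ be the unique measure on $\mathbb{R}$ with moments $\int x^n\,d\mu^{(m)}(x)=M_n^{(m)}$, $n\ge0$. Then $\mu^{(m)}$ converges weakly to the Wigner measure $\mu_W$ as $m\to\infty$.
   Context: $\mathbb{N}=\{1,2,\ldots\}$. The Wigner measure $\mu_W$ is the standard semicircle law, with density $\frac{1}{2\pi}\sqrt{4-x^2}$ on $[-2,2]$; equivalently its odd moments vanish and its $2k$-th moment is $\frac{1}{k+1}\binom{2k}{k}$. For $m,n\in\mathbb{N}$, $M_n^{(m)}=|NC_n^{\rm pair}(m)|$, and $M_0^{(m)}=1$. Here $NC_n^{\rm pair}(m)$ is the set of non-crossing pair partitions of $\{1,\ldots,n\}$ of depth at most $m$ (empty for odd $n$): a pair partition $P=\{P_1,\ldots,P_k\}$ of $\{1,\ldots,2k\}$, $P_j=\{\alpha(j),\beta(j)\}$, $\alpha(j)<\beta(j)$, is non-crossing if there are no $p,q$ with $\alpha(p)<\alpha(q)<\beta(p)<\beta(q)$, and its depth $d(P)$ is the maximal $d$ for which there exist $s_1,\ldots,s_d$ with $\alpha(s_1)<\cdots<\alpha(s_d)$ and $\beta(s_1)>\cdots>\beta(s_d)$. *)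

(* Defs.v *)
From HB Require Import structures.
From mathcomp Require Import all_boot all_order all_algebra.
From mathcomp Require Import all_classical all_reals all_analysis.
From mathcomp Require Import measurable_realfun.

Set Implicit Arguments.
Unset Strict Implicit.
Unset Printing Implicit Defensive.

Import Order.TTheory GRing.Theory Num.Theory.
Import numFieldNormedType.Exports.

(* The ground set {1, ..., n} is represented by 'I_n = {0, ..., n-1}; only the
   order of the points matters below. *)
Section PairPartitions.
Variable n : nat.
Implicit Types (A B : {set 'I_n}) (P : {set {set 'I_n}}).

(* [alpha] and [beta] are meaningful on nonempty blocks only. *)
Definition alpha A : nat := \big[minn/n]_(i in A) (i : nat).
Definition beta A : nat := \max_(i in A) (i : nat).

Definition pair_partition P : bool :=
  finset.partition P [set: 'I_n]%SET && [forall A in P, #|A| == 2].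

Definition noncrossing P : bool :=
  [forall A in P, forall B in P,
    ~~ [&& alpha A < alpha B, alpha B < beta A & beta A < beta B]].

Definition nests A B : bool := (alpha A < alpha B) && (beta B < beta A).

(* A sequence of blocks with strictly increasing [alpha] has no repetition, so
   bounding its length by #|P| loses nothing. *)
Definition depth P : nat :=
  \max_(d < #|P|.+1 | [exists s : d.-tuple {set 'I_n},
                         all (fun A => A \in P) s && sorted nests s]) d.

End PairPartitions.

Definition NCpair (m n : nat) : {set {set {set 'I_n}}} :=
  [set P | [&& pair_partition P, noncrossing P & depth P <= m]]%SET.

Definition Mnum (m n : nat) : nat := if n == 0 then 1 else #|NCpair m n|.

Local Open Scope classical_set_scope.
Local Open Scope ring_scope.

Definition has_moments (R : realType)
    (nu : {measure set (measurableTypeR R) -> \bar R}) (a : nat -> R) : Prop :=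
  forall n : nat,
    nu.-integrable setT (fun x : measurableTypeR R => (x ^+ n)%:E) /\
    (\int[nu]_x (x ^+ n)%:E)%E = (a n)%:E.

Definition converges_weakly (R : realType)
    (mu : nat -> {measure set (measurableTypeR R) -> \bar R})
    (nu : {measure set (measurableTypeR R) -> \bar R}) : Prop :=
  forall f : R -> R, continuous f -> (exists C : R, forall x, `|f x| <= C) ->
    (\int[mu m]_x (f x)%:E)%E @[m --> \oo] --> (\int[nu]_x (f x)%:E)%E.

Section Wigner.
Variable R : realType.

Definition wigner_pdf : R -> R :=
  (fun x => (2 * pi)^-1 * Num.sqrt (4 - x ^+ 2)) \_ `[- 2, 2].

Definition wigner : set (measurableTypeR R) -> \bar R :=
  fun A => (\int[lebesgue_measure]_(x in A) (wigner_pdf x)%:E)%E.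

Lemma wigner_pdf_ge0 x : 0 <= wigner_pdf x.
Proof.
apply: restrict_ge0 => {}x _.
by rewrite mulr_ge0 ?sqrtr_ge0// invr_ge0 mulr_ge0// pi_ge0.
Qed.

Lemma measurable_wigner_pdf : measurable_fun [set: R] wigner_pdf.
Proof.
apply/measurable_restrict => //; apply: measurable_funTS.
apply: continuous_measurable_fun => x.
apply: (@continuousM _ R^o (fun=> (2 * pi)^-1)
  (fun x => Num.sqrt (4 - x ^+ 2))); first exact: cst_continuous.
apply: continuous_comp; last exact: sqrt_continuous.
apply: (@continuousB _ R^o) => //; first exact: cst_continuous.
exact: exprn_continuous.
Qed.

Let wigner0 : wigner set0 = 0%E.
Proof. by rewrite /wigner integral_set0. Qed.

Let wigner_ge0 A : (0 <= wigner A)%E.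
Proof. by apply: integral_ge0 => x _; rewrite lee_fin wigner_pdf_ge0. Qed.

Let wigner_sigma_additive : semi_sigma_additive wigner.
Proof.
move=> /= F mF tF mUF; rewrite /wigner; apply: cvg_toP.
  apply: ereal_nondecreasing_is_cvgn => m n mn.
  apply: lee_sum_nneg_natr => // k _ _; apply: integral_ge0 => /= x _.
  by rewrite lee_fin wigner_pdf_ge0.
rewrite ge0_integral_bigcup//=.
- apply/measurable_funTS/measurableT_comp => //.
  exact: measurable_wigner_pdf.
- by move=> x _; rewrite lee_fin wigner_pdf_ge0.
Qed.

HB.instance Definition _ := isMeasure.Build _ _ _
  wigner wigner0 wigner_ge0 wigner_sigma_additive.

Definition wigner_measure : {measure set (measurableTypeR R) -> \bar R} :=
  wigner.

End Wigner.

(* Main.v *)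
Require Import Defs.
From mathcomp Require Import all_boot all_order all_algebra.
From mathcomp Require Import all_classical all_reals all_analysis.
From mathcomp Require Import measurable_realfun.
From mathcomp Require Import zify ring lra.

(* Recording which points open a block maps the non-crossing pair partitions of
   depth at most m bijectively onto the Dyck words of height at most m, the
   depth being the maximal number of blocks above a point.  Diagonalising the
   adjacency matrix of the path with m + 1 vertices then gives
     M_n^(m) = sum_j w_j x_j^n,   x_j = 2 cos t_j,  w_j = 2/(m+2) sin^2 t_j,
   where t_j = j pi / (m+2) and 1 <= j <= m+1.  A measure nu with these moments
   integrates the square of the monic polynomial vanishing at all x_j to 0, so
   it lives on the atoms x_j, and there every function agrees with a polynomial;
   hence int f dnu = sum_j w_j f(x_j) for all measurable f.  This gives
   uniqueness, and turns int f dmu^(m) into a Riemann sum of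
   (2/pi) sin^2 t f(2 cos t) on [0, pi], whose limit is int f dmu_W by the
   substitution x = 2 cos t. *)

Set Implicit Arguments.
Unset Strict Implicit.
Unset Printing Implicit Defensive.

Import Order.TTheory GRing.Theory Num.Theory.
Import numFieldNormedType.Exports.

(** * Dyck words and the matching of rises with falls *)

Section DyckWords.
Local Open Scope set_scope.
Local Open Scope nat_scope.

(* For a word whose k-th letter is a rise iff [op k], [g k] is the height just
   before the letter k; [matched i j]: the fall j closes the rise i. *)
Section Heights.
Variables (n : nat) (op : nat -> bool) (g : nat -> nat).

Definition steps : Prop := forall k, k < n ->
  if op k then g k.+1 = (g k).+1 else g k = (g k.+1).+1.

Definition matched (i j : nat) : Prop :=
  [/\ i < j, g j.+1 = g i & forall k, i < k <= j -> g i < g k].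

Lemma matched_injr i j j' : matched i j -> matched i j' -> j = j'.
Proof.
move=> [ij gj Hj] [ij' gj' Hj'].
case: (ltngtP j j') => // jj'.
- by have := Hj' j.+1 ltac:(lia); lia.
- by have := Hj j'.+1 ltac:(lia); lia.
Qed.

Lemma matched_injl i i' j : matched i j -> matched i' j -> i = i'.
Proof.
move=> [ij gj Hj] [ij' gj' Hj'].
case: (ltngtP i i') => // ii'.
- by have := Hj i' ltac:(lia); lia.
- by have := Hj' i ltac:(lia); lia.
Qed.

Lemma matched_noncrossing i j i' j' :
  matched i j -> matched i' j' -> ~~ [&& i < i', i' < j & j < j'].
Proof.
move=> [ij gj Hj] [ij' gj' Hj']; apply/negP => /and3P[h1 h2 h3].
have := Hj i' ltac:(lia); have := Hj' j.+1 ltac:(lia); lia.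
Qed.

Hypothesis gsteps : steps.

Lemma matched_op i j : j < n -> matched i j -> op i.
Proof.
move=> jn [ij _ /(_ i.+1)/(_ ltac:(lia)) gi].
by have := gsteps (k := i) ltac:(lia); case: (op i) => //; lia.
Qed.

Lemma matched_not_op i j : j < n -> matched i j -> ~~ op j.
Proof.
move=> jn [ij gj /(_ j)/(_ ltac:(lia)) gi].
by have := gsteps (k := j) ltac:(lia); case: (op j) => //; lia.
Qed.

(** Take the least [j > i] with [g j.+1 <= g i]. It exists because the word ends at height 0, and as
    heights change by one at a time the inequality is an equality. *)
Lemma ex_matchedr i : g n = 0 -> i < n -> op i ->
  exists2 j, j < n & matched i j.
Proof.
move=> gn ilt opi; have := gsteps ilt; rewrite opi => gi.
pose p j := (i < j) && (g j.+1 <= g i).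
have pn : p n.-1.
  rewrite /p prednK ?(leq_ltn_trans _ ilt)// gn leq0n andbT.
  have : i.+1 != n by apply/eqP => e; rewrite e gn in gi; lia.
  lia.
case: (ex_minnP (ex_intro p _ pn)) => j /andP[ij gj] jmin.
have jn : j < n by have := jmin _ pn; lia.
have Hk k : i < k <= j -> g i < g k.
  move=> /andP[ik kj]; have [->|ik1] := eqVneq k i.+1; first by rewrite gi.
  rewrite ltnNge; apply/negP => gk.
  have /jmin : p k.-1 by rewrite /p prednK; lia.
  lia.
exists j => //; split => //; have := gsteps jn.
have := Hk j ltac:(lia); case: (op j); lia.
Qed.

(** Mirror image: the greatest [i < j] with [g i <= g j.+1], which exists because the word starts at
    height 0. *)
Lemma ex_matchedl j : g 0 = 0 -> j < n -> ~~ op j ->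
  exists i, matched i j.
Proof.
move=> g0 jn /negbTE opj; have := gsteps jn; rewrite opj => gj.
pose p i := (i < j) && (g i <= g j.+1).
have p0 : p 0.
  rewrite /p g0 leq0n andbT lt0n; apply/eqP => j0; rewrite j0 in gj; lia.
have pub i : p i -> i <= j by move=> /andP[]; lia.
case: (ex_maxnP (ex_intro p _ p0) pub) => i /andP[ij gi] imax.
have Hk k : i < k <= j -> g j.+1 < g k.
  move=> /andP[ik kj]; have [->|kj1] := eqVneq k j; first by rewrite gj.
  rewrite ltnNge; apply/negP => gk.
  have /imax : p k by rewrite /p; lia.
  lia.
have E : g j.+1 = g i.
  have := gsteps (k := i) ltac:(lia).
  by have := Hk i.+1 ltac:(lia); case: (op i); lia.
by exists i; split => // k kij; rewrite -E Hk.
Qed.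

End Heights.

Lemma steps_inj n op g g' : steps n op g -> steps n op g' -> g 0 = g' 0 ->
  forall k, k <= n -> g k = g' k.
Proof.
move=> gs gs' g0; elim=> [//|k IH] kn.
have := gs k kn; have := gs' k kn; have := IH (ltnW kn); case: (op k); lia.
Qed.

Fixpoint dyck (m h : nat) (s : seq bool) : bool :=
  match s with
  | [::] => h == 0
  | true :: s' => (h < m) && dyck m h.+1 s'
  | false :: s' => (0 < h) && dyck m h.-1 s'
  end.

(** [dyck] tests the bound [m] only at rises, so the starting height has to respect it
    beforehand. *)
Lemma dyckP m h s : h <= m ->
  reflect (exists g, [/\ steps (size s) (nth false s) g, g 0 = h,
                      g (size s) = 0 & forall k, k <= size s -> g k <= m])
          (dyck m h s).
Proof.
move=> hm; apply: (iffP idP).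
  elim: s h hm => [|b s IH] h hm /=.
    by move=> /eqP ->; exists (fun=> 0).
  move=> D.
  have [h' [h'm E /IH -/(_ h'm) [g [gs g0 gn gm]]]] :
      exists h', [/\ h' <= m, if b then h' = h.+1 else h = h'.+1 & dyck m h' s].
    case: b D => /andP[h1 h2]; first by exists h.+1.
    by exists h.-1; split => //; lia.
  exists (fun k => if k is k'.+1 then g k' else h); split => //.
  - move=> [|k] //= ks; last exact: gs.
    by rewrite g0; case: (b) E.
  - by move=> [|k] // ks; apply: gm.
elim: s h hm => [|b s IH] h hm [g [gs g0 gn gm]] /=.
  by rewrite -g0 gn.
have S : exists g', [/\ steps (size s) (nth false s) g', g' 0 = g 1,
                      g' (size s) = 0 & forall k, k <= size s -> g' k <= m].
  exists (fun k => g k.+1); split => //.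
    by move=> k ks; apply: (gs k.+1).
  by move=> k ks; apply: gm.
have g1m := gm 1 isT; have D := IH _ g1m S.
have := gs 0 isT; rewrite g0 /=; case: (b) => E; first by rewrite -E g1m.
by rewrite E.
Qed.

(** * Non-crossing pair partitions and their heights *)

Section Arcs.
Variable n : nat.
Implicit Types (A B : {set 'I_n}) (P Q : {set {set 'I_n}}).

(** The minimum defining [alpha] starts from the default [n], hence the restriction on [x]. *)
Lemma leq_alpha x A : x <= n -> (x <= alpha A) = [forall i in A, x <= i].
Proof.
move=> xn; rewrite /alpha (big_morph (leq x) (leq_min x) (_ : _ = true)) ?xn//.
by rewrite big_andE.
Qed.

Lemma alpha_set2 (i j : 'I_n) : i < j -> alpha [set i; j] = i.
Proof.
move=> ij; apply/eqP; rewrite eqn_leq; apply/andP; split.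
  rewrite leqNgt leq_alpha//; apply/negP => /fintype.forall_inP/(_ i).
  by rewrite !inE eqxx ltnn => /(_ isT).
rewrite leq_alpha; last exact: ltnW.
by apply/fintype.forall_inP => k; rewrite !inE => /orP[]/eqP -> //; exact: ltnW.
Qed.

Lemma beta_set2 (i j : 'I_n) : i < j -> beta [set i; j] = j.
Proof.
move=> ij; rewrite /beta big_setU1 ?inE ?big_set1/=.
  by apply/maxn_idPr; exact: ltnW.
by apply/eqP => e; rewrite e ltnn in ij.
Qed.

Lemma pair_partitionP P :
  reflect [/\ forall A, A \in P -> exists i j : 'I_n, i < j /\ A = [set i; j],
              forall x, exists2 A, A \in P & x \in A &
              forall A B x, A \in P -> B \in P -> x \in A -> x \in B -> A = B]
          (pair_partition P).
Proof.
apply: (iffP idP) =>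
  [/andP[/and3P[/eqP cP tP P0] /fintype.forall_inP c2]|[h1 h2 h3]].
  split.
  - move=> A AP; have /cards2P[i [j [ij ->]]] := c2 _ AP.
    have : (i : nat) != j by [].
    rewrite neq_ltn => /orP[h|h]; first by exists i, j; split.
    by exists j, i; rewrite finset.setUC; split.
  - move=> x; have : x \in finset.cover P by rewrite cP inE.
    by move=> /finset.bigcupP[A]; exists A.
  - move=> A B x AP BP xA xB; apply/eqP/negPn/negP => AB.
    have /finset.trivIsetP/(_ A B AP BP AB) := tP.
    by rewrite -finset.setI_eq0 => /eqP/setP/(_ x); rewrite !inE xA xB.
have c2 A : A \in P -> #|A| == 2.
  move=> /h1[i [j [ij ->]]]; rewrite cards2.
  by have -> : i != j by apply/eqP => e; rewrite e ltnn in ij.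
apply/andP; split; last exact/fintype.forall_inP.
apply/and3P; split.
- apply/eqP/setP => x; rewrite inE; apply/finset.bigcupP.
  by have [A] := h2 x; exists A.
- apply/finset.trivIsetP => A B AP BP AB.
  rewrite -finset.setI_eq0; apply/eqP/setP => x.
  rewrite !inE; apply/negP => /andP[xA xB].
  by move/eqP: AB; apply; apply: h3 xA xB.
- by apply/negP => /c2; rewrite cards0.
Qed.

(* The blocks above the gap between the points k - 1 and k. *)
Definition covering P k := [set A in P | (alpha A < k) && (k <= beta A)].
Definition cov P k := #|covering P k|.
Definition opener P (k : nat) := [exists A in P, alpha A == k].

Lemma openerP P k : reflect (exists2 A, A \in P & alpha A = k) (opener P k).
Proof.
by apply: (iffP fintype.exists_inP) => -[A AP /eqP]; exists A => //; exact/eqP.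
Qed.

Section PairPartition.
Variable P : {set {set 'I_n}}.
Hypothesis pP : pair_partition P.

Lemma blockE A : A \in P ->
  exists i j : 'I_n, [/\ i < j, A = [set i; j], alpha A = i & beta A = j].
Proof.
move=> AP; have [/(_ _ AP)[i [j [ij ->]]] _ _] := pair_partitionP _ pP.
by exists i, j; rewrite alpha_set2// beta_set2.
Qed.

Lemma alpha_beta A : A \in P -> alpha A < beta A < n.
Proof. by move=> /blockE[i [j [ij _ -> ->]]]; rewrite ij ltn_ord. Qed.

Lemma block_eq A B (x : nat) : A \in P -> B \in P ->
  (x == alpha A) || (x == beta A) -> (x == alpha B) || (x == beta B) -> A = B.
Proof.
move=> AP BP; have [_ _ h3] := pair_partitionP _ pP.
have [i [j [ij EA -> ->]]] := blockE AP.
have [k [l [kl EB -> ->]]] := blockE BP.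
move=> xA xB; have xn : x < n by move: xA => /orP[]/eqP ->.
by apply: (h3 A B (Ordinal xn) AP BP); rewrite ?EA ?EB !inE.
Qed.

Lemma block_neq A B : A \in P -> B \in P -> A != B ->
  [/\ alpha A != alpha B, alpha A != beta B,
      beta A != alpha B & beta A != beta B].
Proof.
move=> AP BP AB; split; apply: contraNneq AB => e; apply/eqP.
- by apply: (@block_eq A B (alpha A)) => //; rewrite e eqxx ?orbT.
- by apply: (@block_eq A B (alpha A)) => //; rewrite e eqxx ?orbT.
- by apply: (@block_eq A B (beta A)) => //; rewrite e eqxx ?orbT.
- by apply: (@block_eq A B (beta A)) => //; rewrite e eqxx ?orbT.
Qed.

(** Exactly one block contains the point [k]. Passing [k] adds it to [covering] if [k] is its left
    end, removes it otherwise, and affects no other block. *)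
Lemma cov_steps : steps n (opener P) (cov P).
Proof.
move=> k kn; have [_ h2 _] := pair_partitionP _ pP.
have [A AP kA] := h2 (Ordinal kn).
have kAab : (k == alpha A) || (k == beta A).
  have [i [j [ij EA -> ->]]] := blockE AP.
  by move: kA; rewrite EA !inE.
have ab := alpha_beta AP.
have other B : B \in P -> B != A -> (alpha B != k) && (beta B != k).
  move=> BP /(block_neq BP AP)[? ? ? ?].
  by case/orP: kAab => /eqP ->; apply/andP.
have [ka|ka] := eqVneq (alpha A) k.
  have -> : opener P k by apply/openerP; exists A.
  rewrite /cov (_ : covering P k.+1 = A |: covering P k); last first.
    apply/setP => B; rewrite !inE; have [->|BA] := eqVneq B A.
      by rewrite AP /=; lia.
    have [BP|//] := boolP (B \in P); have := other _ BP BA; lia.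
  by rewrite cardsU1 !inE ka ltnn andbF.
have kb : beta A = k by move: kAab; rewrite eq_sym (negbTE ka) => /eqP.
have -> : opener P k = false.
  apply/openerP => -[B BP kB].
  have [e|BA] := eqVneq B A; first by rewrite e in kB; rewrite kB eqxx in ka.
  by have := other _ BP BA; rewrite kB eqxx.
rewrite /cov (_ : covering P k = A |: covering P k.+1); last first.
  apply/setP => B; rewrite !inE; have [->|BA] := eqVneq B A.
    by rewrite AP /=; lia.
  have [BP|//] := boolP (B \in P); have := other _ BP BA; lia.
by rewrite cardsU1 !inE kb ltnn !andbF.
Qed.

Lemma cov0 : cov P 0 = 0.
Proof.
by apply/eqP; rewrite cards_eq0; apply/eqP/setP => A; rewrite !inE andbF.
Qed.

Lemma cov_out k : n <= k -> cov P k = 0.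
Proof.
move=> nk; apply/eqP; rewrite cards_eq0; apply/eqP/setP => A; rewrite !inE.
by apply/negP => /andP[/alpha_beta]; lia.
Qed.

Hypothesis ncP : noncrossing P.

Lemma noncrossingE A B : A \in P -> B \in P ->
  ~~ [&& alpha A < alpha B, alpha B < beta A & beta A < beta B].
Proof.
move=> AP BP.
by move/fintype.forall_inP/(_ _ AP)/fintype.forall_inP: ncP; apply.
Qed.

(** Without crossings, the blocks above the gap before [alpha A] are those enclosing [A]. The same
    blocks lie above the gap after [beta A], and in between [A] joins them. *)
Lemma block_matched A : A \in P -> matched (cov P) (alpha A) (beta A).
Proof.
move=> AP; have ab := alpha_beta AP.
have out B : B \in covering P (alpha A) -> beta A < beta B.
  rewrite !inE => /andP[BP cB].
  have [e|BA] := eqVneq B A; first by rewrite e in cB; lia.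
  by have := noncrossingE BP AP; have [] := block_neq BP AP BA; lia.
split; first lia.
  congr #|pred_of_set _|; apply/eqP.
  rewrite finset.eqEsubset; apply/andP; split.
    apply/fintype.subsetP => B; rewrite !inE => /andP[BP cB]; rewrite BP /=.
    have [e|BA] := eqVneq B A; first by rewrite e in cB; lia.
    by have := noncrossingE AP BP; have [] := block_neq BP AP BA; lia.
  apply/fintype.subsetP => B BC; have := out _ BC.
  by move: BC; rewrite !inE => /andP[-> ]; lia.
move=> k kab; have ltS : A |: covering P (alpha A) \subset covering P k.
  apply/fintype.subsetP => B; rewrite finset.in_setU1 => /orP[/eqP ->|BC].
    by rewrite !inE AP; lia.
  have := out _ BC.
  by move: BC; rewrite !inE => /andP[-> ]; lia.
by move/subset_leq_card: ltS; rewrite cardsU1 !inE ltnn andbF.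
Qed.

Lemma nests_trans : transitive (@nests n).
Proof. by move=> B A C; rewrite /nests; lia. Qed.

(** All blocks of a nested chain lie above the gap right after the innermost opening. Conversely,
    blocks above a common gap are pairwise nested, so sorted by [alpha] they form a chain. *)
Lemma depth_leq m : (depth P <= m) <-> (forall k, cov P k <= m).
Proof.
split=> [/bigmax_leqP dm k|cm]; last first.
  apply/bigmax_leqP => d /existsP[s /andP[sP ss]].
  rewrite -(size_tuple s); move: (val s) sP ss => {d}s.
  case/lastP: s => // s A; rewrite all_rcons => /andP[AP sP] ss.
  have us : uniq (rcons s A).
    apply: sorted_uniq ss; first exact: nests_trans.
    by move=> B; rewrite /nests ltnn.
  apply: leq_trans (cm (alpha A).+1); rewrite -(card_uniqP us).
  apply/subset_leq_card/fintype.subsetP => B; rewrite mem_rcons inE.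
  move: ss; rewrite (sorted_pairwise nests_trans) pairwise_rcons.
  move=> /andP[/allP ns _].
  case/orP => [/eqP ->|Bs].
    by rewrite inE AP ltnSn; have := alpha_beta AP; lia.
  have := ns _ Bs; rewrite inE (allP sP)// /nests; have := alpha_beta AP; lia.
pose r := [rel A B : {set 'I_n} | alpha A <= alpha B].
have rtr : transitive r by move=> A B C /=; lia.
have rtot : total r by move=> A B /=; lia.
pose s := sort r (enum (covering P k)).
have ss : size s = cov P k by rewrite size_sort -cardE.
have sC A : A \in s -> A \in covering P k by rewrite mem_sort mem_enum.
have cP : cov P k < #|P|.+1.
  rewrite ltnS; apply/subset_leq_card/fintype.subsetP => A.
  by rewrite inE => /andP[].
have /eqP ss' := ss.
apply: (dm (Ordinal cP)); apply/existsP; exists (Tuple ss'); apply/andP; split.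
  by apply/allP => A /sC; rewrite inE => /andP[].
rewrite /= (sorted_pairwise nests_trans).
have : pairwise r s by rewrite -sorted_pairwise// sort_sorted.
(* Sorting gives only [<=] between left ends; distinctness makes it strict, and the absence of
   crossings then orders the right ends. *)
have : pairwise [rel x y | x != y] s.
  by rewrite -uniq_pairwise sort_uniq enum_uniq.
move=> h1 h2.
have : pairwise [rel x y | [rel x y | x != y] x y && r x y] s.
  by rewrite pairwise_relI h1.
apply: (sub_in_pairwise (P := mem s)); last exact/allP.
move=> A B /sC AC /sC BC /andP[/= AB]; rewrite /nests.
move: AC BC; rewrite !inE => /andP[AP cA] /andP[BP cB] ab.
have := noncrossingE AP BP; have [] := block_neq AP BP AB; lia.
Qed.

End PairPartition.

Definition word P : n.-tuple bool := [tuple opener P i | i < n].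

Lemma nth_word P k : k < n -> nth false (word P) k = opener P k.
Proof.
by move=> kn; rewrite (_ : k = Ordinal kn)// -tnth_nth tnth_mktuple.
Qed.

Lemma word_cov P Q : pair_partition P -> pair_partition Q ->
  word P = word Q -> cov P =1 cov Q.
Proof.
move=> pP pQ PQ k; have [kn|/ltnW nk] := leqP k n; last by rewrite !cov_out.
apply: (steps_inj (cov_steps pP) (g' := cov Q)) kn; last by rewrite !cov0.
move=> i ilt; have := cov_steps pQ ilt.
by rewrite -!nth_word// PQ.
Qed.

(** The word determines the heights, and these determine which fall closes each rise. *)
Lemma word_inj_sub P Q : pair_partition P -> noncrossing P ->
  pair_partition Q -> noncrossing Q -> word P = word Q -> P \subset Q.
Proof.
move=> pP nP pQ nQ PQ; apply/fintype.subsetP => A AP.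
have /funext cPQ := word_cov pP pQ PQ.
have mA := block_matched pP nP AP.
have an : alpha A < n by have := alpha_beta pP AP; lia.
have : opener Q (alpha A).
  by rewrite -nth_word// -PQ nth_word//; apply/openerP; exists A.
move=> /openerP[B BQ BA].
have := block_matched pQ nQ BQ; rewrite -cPQ BA => /(matched_injr mA) bAB.
have [i [j [_ EA ai bj]]] := blockE pP AP.
have [i' [j' [_ EB ai' bj']]] := blockE pQ BQ.
have ii : i = i' by apply: val_inj; rewrite /= -ai -ai' BA.
have jj : j = j' by apply: val_inj; rewrite /= -bj -bj' bAB.
by rewrite EA ii jj -EB.
Qed.

End Arcs.

(** * The bijection with Dyck words *)

Section Count.
Variables (m n : nat).

Lemma word_inj : {in NCpair m n &, injective (@word n)}.
Proof.
move=> P Q; rewrite !inE => /and3P[pP nP _] /and3P[pQ nQ _] PQ.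
by apply/eqP; rewrite finset.eqEsubset !word_inj_sub.
Qed.

Lemma word_dyck P : P \in NCpair m n -> dyck m 0 (word P).
Proof.
rewrite !inE => /and3P[pP nP dP]; apply/dyckP => //.
exists (cov P); rewrite size_tuple; split.
- by move=> k kn; rewrite nth_word//; exact: cov_steps.
- exact: cov0.
- exact: cov_out.
- by move=> k _; move/(depth_leq pP nP): dP; exact.
Qed.

(** The inverse of [word]: each rise of [t] is joined to the fall that closes it. *)
Lemma dyck_word (t : n.-tuple bool) : dyck m 0 t ->
  exists2 P, P \in NCpair m n & word P = t.
Proof.
case/dyckP => // g []; rewrite size_tuple => gs g0 gn gm.
pose mt (i j : 'I_n) := `[< matched g i j >].
pose P := [set A : {set 'I_n} |
  [exists i, exists j, mt i j && (A == [set i; j])]].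
have inP A : A \in P -> exists i j : 'I_n, matched g i j /\ A = [set i; j].
  rewrite inE => /existsP[i /existsP[j /andP[/asboolP ? /eqP ->]]].
  by exists i, j.
have Pin (i j : 'I_n) : matched g i j -> [set i; j] \in P.
  move=> ij; rewrite inE; apply/existsP; exists i; apply/existsP; exists j.
  by rewrite eqxx andbT; exact/asboolP.
(* The letter at a point tells which end of its arc it is. Arcs with a common point thus share the
   same end, and coincide because partners are unique. *)
have end_op (i j x : 'I_n) : matched g i j -> x \in [set i; j] ->
    x = if nth false t x then i else j.
  move=> ij; rewrite !inE => /orP[] /eqP ->.
    by rewrite (matched_op gs _ ij).
  by rewrite (negbTE (matched_not_op gs _ ij)).
have pP : pair_partition P.
  apply/pair_partitionP; split.
  - by move=> A /inP[i [j [ij ->]]]; exists i, j; case: ij.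
  - move=> x; have [ox|ox] := boolP (nth false t x).
      have [j jn xj] := ex_matchedr gs gn (ltn_ord x) ox.
      exists [set x; Ordinal jn]; last by rewrite !inE eqxx.
      exact: (Pin x (Ordinal jn)).
    have [i ix] := ex_matchedl gs g0 (ltn_ord x) ox.
    have ilt : i < n by case: ix => ix _ _; have := ltn_ord x; lia.
    exists [set Ordinal ilt; x]; last by rewrite !inE eqxx orbT.
    exact: (Pin (Ordinal ilt) x).
  - move=> A B x /inP[i [j [ij ->]]] /inP[i' [j' [ij' ->]]].
    move=> /(end_op _ _ _ ij) xA /(end_op _ _ _ ij') xB.
    move: xB; rewrite [LHS]xA; case: ifP => _ e; rewrite e in ij *.
      by have /val_inj -> := matched_injr ij ij'.
    by have /val_inj -> := matched_injl ij ij'.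
have inP' A : A \in P -> exists i j : 'I_n,
    [/\ matched g i j, A = [set i; j], alpha A = i & beta A = j].
  move=> /inP[i [j [ij ->]]]; exists i, j.
  by rewrite alpha_set2 ?beta_set2//; case: ij.
have nP : noncrossing P.
  apply/fintype.forall_inP => A /inP'[i [j [ij _ -> ->]]].
  apply/fintype.forall_inP => B /inP'[i' [j' [ij' _ -> ->]]].
  exact: matched_noncrossing ij ij'.
have wP : word P = t.
  apply: eq_from_tnth => k; rewrite tnth_mktuple (tnth_nth false).
  apply/idP/idP => [/openerP[A /inP'[i [j [ij _ -> _]]] <-]|ok].
    exact: (matched_op gs _ ij).
  have [j jn kj] := ex_matchedr gs gn (ltn_ord k) ok.
  apply/openerP; exists [set k; Ordinal jn]; first exact: (Pin k (Ordinal jn)).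
  by rewrite alpha_set2//; case: kj.
exists P => //; rewrite inE pP nP /=; apply/(depth_leq pP nP) => k.
have [kn|/ltnW nk] := leqP k n; last by rewrite cov_out.
(* Both height functions have the steps of [t] and start at 0, so the bound on [g] passes to
   [cov P]. *)
rewrite (steps_inj (cov_steps pP) (g' := g)) ?cov0 ?gm//.
by move=> i ilt; have := gs i ilt; rewrite -wP nth_word.
Qed.

Lemma card_NCpair : #|NCpair m n| = \sum_(t : n.-tuple bool) dyck m 0 t.
Proof.
rewrite -(card_in_imset word_inj) -sum1_card.
rewrite [RHS](bigID (fun t : n.-tuple bool => dyck m 0 t))/=.
rewrite [X in _ = _ + X]big1 ?addn0; last by move=> t /negbTE ->.
rewrite [RHS](eq_bigr (fun=> 1)); last by move=> t ->.
apply: eq_bigl => t; apply/imsetP/idP => [[P PN ->]|/dyck_word[P PN <-]].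
  exact: word_dyck.
by exists P.
Qed.

End Count.

(** * Counting words by length and starting height *)

Definition dyck_count m n h := \sum_(t : n.-tuple bool) dyck m h t.

Lemma dyck_count0 m h : dyck_count m 0 h = (h == 0).
Proof.
rewrite /dyck_count (big_pred1 [tuple]) //.
by move=> t; rewrite (tuple0 t); exact/esym/eqP.
Qed.

(** Splitting off the first letter applies the adjacency matrix of the path on the heights 0, ...,
    m; the boolean factors cut the path at its two ends. *)
Lemma dyck_countS m n h : dyck_count m n.+1 h =
  (h < m) * dyck_count m n h.+1 + (0 < h) * dyck_count m n h.-1.
Proof.
rewrite /dyck_count.
pose f (p : bool * n.-tuple bool) := [tuple of p.1 :: p.2].
rewrite (reindex f) /=; last first.
  exists (fun t => (thead t, [tuple of behead t])).
    by move=> [b t] _; rewrite /f theadE; congr pair; apply: val_inj.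
  move=> t _; rewrite /f; case/tupleP: t => b t.
  by apply: val_inj; rewrite /= theadE.
rewrite -(pair_big xpredT xpredT
  (fun b (t : n.-tuple bool) => (dyck m h (b :: t) : nat)))/=.
rewrite big_bool /= !big_distrr /=.
by congr (_ + _); apply: eq_bigr => t _; rewrite mulnb.
Qed.

Lemma Mnum_dyck m n : Mnum m n = dyck_count m n 0.
Proof.
by rewrite /Mnum; case: eqP => [->|_]; rewrite ?dyck_count0// card_NCpair.
Qed.

End DyckWords.

Local Open Scope classical_set_scope.
Local Open Scope ring_scope.

(** * Spectral formula for the moments *)

Section Chebyshev.
Variables (R : realType) (m : nat).

Definition angle (j : nat) : R := pi * j%:R / m.+2%:R.
(* Indexed from 0: [atom j] and [weight j] belong to the angle t_(j+1). *)
Definition atom (j : nat) : R := 2 * cos (angle j.+1).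
Definition weight (j : nat) : R := 2 / m.+2%:R * sin (angle j.+1) ^+ 2.

Lemma sin_natpi (k : nat) : sin (k%:R * pi : R) = 0.
Proof.
elim: k => [|k IH]; first by rewrite mul0r sin0.
by rewrite -natr1 mulrDl mul1r sinDpi IH oppr0.
Qed.

Lemma cos_natpiD2 (k : nat) : cos (k.+2%:R * pi : R) = cos (k%:R * pi).
Proof. by rewrite -!natr1 !mulrDl mul1r !cosDpi opprK. Qed.

(** Multiplied by [sin phi], the sum telescopes. The range of [k] puts [phi] strictly between 0 and
    pi, where the sine does not vanish. *)
Lemma sum_cos_angle k : (0 < k < m.+2.*2)%N ->
  \sum_(j < m.+1) cos (k%:R * angle j.+1) = - (1 + cos (k%:R * pi)) / 2.
Proof.
move=> /andP[k0 kN]; pose phi : R := k%:R * pi / m.+2.*2%:R.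
have N0 : 0 < m.+2%:R :> R by rewrite ltr0n.
have NE : m.+2.*2%:R = 2 * m.+2%:R :> R by rewrite -muln2 natrM mulrC.
have phi_gt0 : 0 < sin phi.
  apply: sin_gt0_pi; rewrite /phi; apply/andP; split.
    by rewrite divr_gt0 ?mulr_gt0 ?ltr0n ?pi_gt0.
  rewrite ltr_pdivrMr; last by rewrite ltr0n.
  by rewrite mulrC ltr_pM2l ?pi_gt0// ltr_nat.
apply: (mulfI (lt0r_neq0 phi_gt0)); rewrite mulr_sumr.
(* Chosen so that [u j.+2 - u j.+1] is [sin phi] times the cosine with index [j]. *)
pose u j : R := sin (j%:R * phi *+ 2 - phi) / 2.
transitivity (\sum_(0 <= j < m.+1) (u j.+2 - u j.+1)).
  rewrite big_mkord; apply: eq_bigr => j _.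
  have -> : k%:R * angle j.+1 = j.+1%:R * phi *+ 2.
    by rewrite /angle /phi NE; field; lra.
  rewrite /u -[in j.+2%:R]natr1; set t := j.+1%:R.
  have -> : (t + 1) * phi *+ 2 - phi = t * phi *+ 2 + phi by ring.
  by rewrite sinD sinB; field.
rewrite telescope_sumr//= /u mulr1n.
have -> : m.+2%:R * phi *+ 2 - phi = k%:R * pi - phi.
  by rewrite /phi NE; field; lra.
have -> : 1 * phi *+ 2 - phi = phi by ring.
by rewrite sinB sin_natpi; field.
Qed.

(** The product of sines is half a difference of cosines with frequencies [h] and [h + 2]. These
    have equal parity, so the two sums cancel unless [h = 0]. *)
Lemma sum_sin_angle h : (h <= m)%N ->
  \sum_(j < m.+1) 2 / m.+2%:R * sin (angle j.+1) * sin (h.+1%:R * angle j.+1)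
  = (h == 0%N)%:R :> R.
Proof.
move=> hm; have N0 : 0 < m.+2%:R :> R by rewrite ltr0n.
transitivity (m.+2%:R^-1 * (\sum_(j < m.+1) cos (h%:R * angle j.+1) -
                       \sum_(j < m.+1) cos (h.+2%:R * angle j.+1))).
  rewrite -sumrB mulr_sumr; apply: eq_bigr => j _.
  set t := angle _; rewrite -[h.+2%:R]natr1 -[h.+1%:R]natr1.
  have -> : h%:R * t = (h%:R + 1) * t - t by ring.
  have -> : (h%:R + 1 + 1) * t = (h%:R + 1) * t + t by ring.
  by rewrite cosB cosD; field; lra.
have [->|h0] := eqVneq h 0%N.
  under eq_bigr do rewrite mul0r cos0.
  rewrite sum_cos_angle// sumr_const card_ord cos_natpiD2 mul0r cos0.
  by have m0 := ler0n R m; rewrite -[m.+2%:R]natr1 -natr1 mulr1n; field; lra.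
by rewrite !sum_cos_angle ?cos_natpiD2 ?subrr ?mulr0//; lia.
Qed.

(** As a function of [h], the sine of [h + 1] times the angle is an eigenvector of the path with
    eigenvalue [atom j]: it vanishes at the virtual heights -1 and [m + 1]. Orthogonality is the
    case [n = 0]. *)
Lemma dyck_count_sum n h : (h <= m)%N ->
  (dyck_count m n h)%:R =
  \sum_(j < m.+1) 2 / m.+2%:R * sin (angle j.+1) * sin (h.+1%:R * angle j.+1)
                  * atom j ^+ n :> R.
Proof.
have N0 : 0 < m.+2%:R :> R by rewrite ltr0n.
elim: n h => [|n IH] h hm.
  rewrite dyck_count0 -sum_sin_angle//.
  by apply: eq_bigr => j _; rewrite expr0 mulr1.
have up : ((h < m) * dyck_count m n h.+1)%:R =
    \sum_(j < m.+1) 2 / m.+2%:R * sin (angle j.+1) * sin (h.+2%:R * angle j.+1)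
                  * atom j ^+ n :> R.
  have [hm'|mh] := ltnP h m; first by rewrite mul1n IH.
  have -> : h = m by apply/eqP; rewrite eqn_leq hm mh.
  rewrite mul0n big1// => j _.
  have -> : m.+2%:R * angle j.+1 = j.+1%:R * pi.
    by rewrite /angle; field; exact: lt0r_neq0.
  by rewrite sin_natpi mulr0 mul0r.
have dn : ((0 < h) * dyck_count m n h.-1)%:R =
    \sum_(j < m.+1) 2 / m.+2%:R * sin (angle j.+1) * sin (h%:R * angle j.+1)
                  * atom j ^+ n :> R.
  case: (h) hm => [|h'] hm /=; last by rewrite mul1n IH// ltnW.
  by rewrite mul0n big1// => j _; rewrite mul0r sin0 mulr0 mul0r.
rewrite dyck_countS natrD up dn -big_split; apply: eq_bigr => j _ /=.
rewrite [in RHS]exprS [X in _ = _ * (X * _)]/atom; set t := angle _.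
rewrite -[h.+2%:R]natr1 -[h.+1%:R]natr1.
have -> : h%:R * t = (h%:R + 1) * t - t by ring.
have -> : (h%:R + 1 + 1) * t = (h%:R + 1) * t + t by ring.
by rewrite sinB sinD; field; exact: lt0r_neq0.
Qed.

Lemma Mnum_sum n :
  (Mnum m n)%:R = \sum_(j < m.+1) weight j * atom j ^+ n :> R.
Proof.
rewrite Mnum_dyck dyck_count_sum//.
by apply: eq_bigr => j _; rewrite /weight mul1r expr2 !mulrA.
Qed.

End Chebyshev.

(** * Moment problem for finitely many atoms *)

(** Newton's scheme: a multiple of the polynomial vanishing at the earlier nodes corrects the value
    at a new one. *)
Lemma poly_interpolation (F : fieldType) (s : seq F) (f : F -> F) :
  exists p : {poly F}, {in s, forall x, p.[x] = f x}.
Proof.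
elim: s => [|a s [p ps]]; first by exists 0.
have [sa|sa] := boolP (a \in s).
  by exists p => x; rewrite inE => /orP[/eqP ->|/ps//]; exact: ps.
pose v := \prod_(b <- s) ('X - b%:P).
have va : v.[a] != 0.
  by rewrite -rootE root_prod_XsubC.
exists (p + ((f a - p.[a]) / v.[a])%:P * v) => x.
rewrite inE !hornerE => /orP[/eqP ->|xs]; first by field.
have /rootP -> : root v x by rewrite root_prod_XsubC.
by rewrite mulr0 addr0 ps.
Qed.

Section AtomicMoments.
Variables (R : realType) (k : nat) (w x : nat -> R).
Implicit Types (nu : {measure set (measurableTypeR R) -> \bar R}) (p : {poly R}).

Lemma measurable_horner p : measurable_fun [set: R] (horner p).
Proof. by apply: continuous_measurable_fun; exact: continuous_horner. Qed.

Section Determinacy.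
Variable nu : {measure set (measurableTypeR R) -> \bar R}.
Hypothesis nu_moments : has_moments nu (fun n => \sum_(j < k) w j * x j ^+ n).

Lemma integral_poly p :
  (\int[nu]_y (p.[y])%:E = (\sum_(j < k) w j * p.[x j])%:E)%E.
Proof.
under eq_integral do rewrite horner_coef -sumEFin.
under eq_integral do under eq_bigr do rewrite EFinM.
rewrite (@integral_sum _ _ _ nu setT measurableT _
  (fun (i : 'I_(size p)) y => ((p`_i)%:E * (y ^+ i)%:E)%E)); last first.
  by move=> i; apply: integrableZl => //; have [] := nu_moments i.
under eq_bigr => i _.
  have [int_i mom_i] := nu_moments i.
  rewrite (integralZl measurableT int_i) mom_i -EFinM mulr_sumr.
  over.
rewrite sumEFin exchange_big /=; congr EFin; apply: eq_bigr => j _.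
by rewrite horner_coef mulr_sumr; apply: eq_bigr => i _; rewrite mulrCA.
Qed.

(* The square of the monic polynomial vanishing at the atoms has integral 0. *)
Lemma moments_ae_atoms : {ae nu, forall y, y \in [seq x j | j <- iota 0 k]}.
Proof.
pose s := [seq x j | j <- iota 0 k].
pose v := \prod_(b <- s) ('X - b%:P).
have root_v y : (v.[y] == 0) = (y \in s) by rewrite -rootE root_prod_XsubC.
have : (\int[nu]_y `|((v ^+ 2).[y])%:E| = 0)%E.
  under eq_integral do
    rewrite abse_EFin ger0_norm ?horner_exp ?sqr_ge0// -horner_exp.
  rewrite integral_poly big1// => j _; rewrite horner_exp.
  have /eqP -> : v.[x j] == 0.
    by rewrite root_v map_f// mem_iota /= add0n.
  by rewrite expr0n mulr0.
have mv : measurable_fun [set: measurableTypeR R] (fun y => ((v ^+ 2).[y])%:E).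
  by apply/measurable_EFinP; exact: measurable_horner.
move/(ae_eq_integral_abs nu measurableT mv).
apply: filterS => y /(_ I) /= [] /eqP.
by rewrite horner_exp expf_eq0 root_v.
Qed.

(** At the atoms, hence [nu]-almost everywhere, [f] agrees with an interpolating polynomial, whose
    integral is known from the moments. *)
Lemma integral_moments_atoms (f : R -> R) : measurable_fun setT f ->
  (\int[nu]_y (f y)%:E = (\sum_(j < k) w j * f (x j))%:E)%E.
Proof.
move=> mf; have [p pf] := poly_interpolation [seq x j | j <- iota 0 k] f.
transitivity (\int[nu]_y (p.[y])%:E)%E.
  apply: ae_eq_integral => //.
  - exact/measurable_EFinP.
  - by apply/measurable_EFinP; exact: measurable_horner.
  - move: moments_ae_atoms.
    apply: (@filterS _ _ (ae_filter_ringOfSetsType nu)) => y ys _.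
    by rewrite /= pf.
rewrite integral_poly; congr EFin; apply: eq_bigr => j _.
by rewrite pf// map_f// mem_iota /= add0n.
Qed.

End Determinacy.

Lemma atomic_moments_unique nu nu' :
  has_moments nu (fun n => \sum_(j < k) w j * x j ^+ n) ->
  has_moments nu' (fun n => \sum_(j < k) w j * x j ^+ n) ->
  forall A : set (measurableTypeR R), measurable A -> nu A = nu' A.
Proof.
move=> hnu hnu' A mA.
have m1 : measurable_fun setT (\1_A : R -> R) by exact: measurable_indic.
transitivity (\int[nu]_y (\1_A y)%:E)%E.
  by rewrite integral_indic// setIT.
rewrite (integral_moments_atoms hnu m1) -(integral_moments_atoms hnu' m1).
by rewrite integral_indic// setIT.
Qed.

Hypothesis w_ge0 : forall j, 0 <= w j.

(** The witness is the sum of the point masses [w j] at [x j]. *)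
Lemma atomic_moments_exist :
  exists mu : {measure set (measurableTypeR R) -> \bar R},
    has_moments mu (fun n => \sum_(j < k) w j * x j ^+ n).
Proof.
pose mu_ (j : nat) : {measure set (measurableTypeR R) -> \bar R} :=
  mscale (NngNum (w_ge0 j)) (@dirac _ (measurableTypeR R) (x j) R).
pose mu : {measure set (measurableTypeR R) -> \bar R} := msum mu_ k.
have int_ge0 (f : R -> R) : measurable_fun setT f -> (forall y, 0 <= f y) ->
    (\int[mu]_y (f y)%:E = (\sum_(j < k) w j * f (x j))%:E)%E.
  move=> mf f0.
  have mf' : measurable_fun [set: measurableTypeR R] (fun y => (f y)%:E).
    exact/measurable_EFinP.
  rewrite ge0_integral_measure_sum//; last by move=> y _; rewrite lee_fin.
  rewrite -sumEFin; apply: eq_bigr => j _.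
  rewrite ge0_integral_mscale//; last by move=> y _; rewrite lee_fin.
  by rewrite integral_dirac// diracT mul1e.
exists mu => n.
have mX : measurable_fun setT (fun y : R => y ^+ n).
  by apply: continuous_measurable_fun; exact: exprn_continuous.
split.
  apply/integrableP; split; first exact/measurable_EFinP.
  under eq_integral do rewrite abse_EFin.
  rewrite int_ge0 ?ltry//.
  exact: measurableT_comp mX.
(* Powers may be negative, so [int_ge0] is applied to their positive and negative parts. *)
have max_ge0 (r : R) : 0 <= Num.max r 0 by rewrite le_max lexx orbT.
have mpos : measurable_fun setT (fun y : R => Num.max (y ^+ n) 0).
  by apply: measurable_maxr => //; exact: measurable_cst.
have mneg : measurable_fun setT (fun y : R => Num.max (- y ^+ n) 0).
  apply: measurable_maxr; last exact: measurable_cst.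
  exact: measurableT_comp (@oppr_measurable R setT) mX.
rewrite integralE.
under eq_integral do rewrite funeposE -EFin_max.
under [X in (_ - X)%E]eq_integral do rewrite funenegE -EFinN -EFin_max.
rewrite !int_ge0//.
rewrite -EFinB -sumrB; congr EFin; apply: eq_bigr => j _.
rewrite -mulrBr; congr (_ * _); set t := _ ^+ _.
have [t0|t0] := lerP 0 t.
  by rewrite max_r ?oppr_le0// subr0.
by rewrite max_l ?oppr_ge0 ?ltW// sub0r opprK.
Qed.

End AtomicMoments.

(** * Uniform continuity and Riemann sums *)

Section RiemannSums.
Variable R : realType.
Implicit Types (f G : R -> R) (L e : R).

(** Heine-Cantor, in a form where only [x] is confined to [K]. *)
Lemma compact_uniform_continuity (K : set R) f e : compact K -> continuous f ->
  0 < e -> exists2 d, 0 < d &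
    forall x y, K x -> `|x - y| < d -> `|f x - f y| < e.
Proof.
move=> /compact_near_coveringP cK cf e0.
pose P d x := forall y, `|x - y| < d -> `|f x - f y| < e.
have : \forall d \near 0^'+, K `<=` P d.
  apply: cK => x Kx.
  have e2 : 0 < e / 2 by lra.
  have /cvgrPdist_lt/(_ _ e2) := cf x.
  move=> /nbhs_ballP[r /= r0 br].
  have r2 : 0 < r / 2 by lra.
  (* With half the radius for each of the two distances, both [x'] and [y] stay within [r] of
     [x]. *)
  exists (ball x (r / 2), [set d | d < r / 2]) => /=.
    by split; [exact: nbhsx_ballx|exact: nbhs_right_lt].
  move=> [x' d] /= [xx' dr] y x'y.
  have h1 : `|f x - f x'| < e / 2.
    by apply: br; apply: le_ball xx'; lra.
  have h2 : `|f x - f y| < e / 2.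
    apply: br; rewrite /ball /=; rewrite /ball /= in xx'.
    by have := ler_distD x' x y; lra.
  have := ler_distD (f x) (f x') (f y); rewrite [`|f x' - f x|]distrC; lra.
move=> Kd; near (0 : R)^'+ => d.
exists d; first by near: d; exact: nbhs_right_gt.
by move=> x y Kx; apply: (near Kd d).
Unshelve. all: by end_near. Qed.

(** The mean value theorem turns each increment of [G] into the mesh times [f c] with [c] in the
    cell; uniform continuity then replaces [c] by the right end point. *)
Lemma cvg_riemann_sum G f L : 0 < L -> continuous f ->
  (forall x : R, is_derive x 1 G (f x)) ->
  \sum_(j < n.+1) f (L * j.+1%:R / n.+1%:R) * (L / n.+1%:R) @[n --> \oo]
    --> G L - G 0.
Proof.
move=> L0 cf dG; apply/cvgrPdist_lt => e e0.
have eL : 0 < e / L by rewrite divr_gt0.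
have [d d0 fd] := compact_uniform_continuity (@segment_compact R 0 L) cf eL.
near=> n; have n0 : 0 < n.+1%:R :> R by rewrite ltr0n.
pose t (j : nat) := L * j%:R / n.+1%:R.
have dt j : t j.+1 - t j = L / n.+1%:R.
  by rewrite /t -[j.+1%:R]natr1; field; exact: lt0r_neq0.
have dt0 : 0 < L / n.+1%:R by rewrite divr_gt0.
have -> : G L - G 0 = \sum_(0 <= j < n.+1) (G (t j.+1) - G (t j)).
  rewrite telescope_sumr// /t mulr0 mul0r mulfK//; exact: lt0r_neq0.
rewrite big_mkord -sumrB; apply: le_lt_trans (ler_norm_sum _ _ _) _.
(* The tolerance is spread evenly over the cells. *)
have -> : e = \sum_(j < n.+1) (e / L * (L / n.+1%:R)).
  rewrite sumr_const card_ord -mulr_natr.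
  by field; apply/andP; split; exact: lt0r_neq0.
have term (j : 'I_n.+1) : `|G (t j.+1) - G (t j) - f (t j.+1) * (L / n.+1%:R)|
    < e / L * (L / n.+1%:R).
  have tj : t j < t j.+1 by rewrite -subr_gt0 dt.
  have cG : {within `[t j, t j.+1], continuous G}.
    by apply: derivable_within_continuous => x _; have /@ex_derive := dG x.
  have [c cj ->] := MVT tj (fun x _ => dG x) cG.
  rewrite in_itv /= in cj; move/andP: cj => [c1 c2].
  rewrite dt -mulrBl normrM (gtr0_norm dt0) ltr_pM2r// distrC.
  apply: fd.
    rewrite /= in_itv /= /t; apply/andP; split.
      by rewrite divr_ge0 ?mulr_ge0 ?ltW.
    by rewrite ler_pdivrMr// ler_pM2l// ler_nat.
  have -> : `|t j.+1 - c| < d.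
    rewrite gtr0_norm ?subr_gt0//.
    apply: (@lt_trans _ _ (L / n.+1%:R)); first by rewrite -(dt j) ltrD2l ltrN2.
    rewrite ltr_pdivrMr// mulrC -ltr_pdivrMr//.
    (* It suffices that [n > L / d], which holds eventually. *)
    apply: (@lt_trans _ _ n%:R); last by rewrite ltr_nat.
    by near: n; exact: nbhs_infty_gtr.
  by [].
apply: ltr_sum => [|j _]; last exact: term.
by apply/hasP; exists ord0; rewrite ?mem_index_enum.
Unshelve. all: by end_near. Qed.

End RiemannSums.

(** * Integration against the semicircle law *)

Section WignerIntegral.
Variable R : realType.
Local Notation leb := (@lebesgue_measure R).
Local Notation W := (wigner_measure R).
Local Notation pdf := (@wigner_pdf R).
Implicit Types f : R -> R.

Let mpdf : measurable_fun [set: R] (fun x => (pdf x)%:E).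
Proof. by apply/measurable_EFinP; exact: measurable_wigner_pdf. Qed.

Let pdf0 x : (0 <= (pdf x)%:E)%E.
Proof. by rewrite lee_fin wigner_pdf_ge0. Qed.

Import HBNNSimple.

(** Both sides are finite sums over the values of [h], and on each level set they agree by
    definition of [wigner]. *)
Lemma sintegral_wigner (h : {nnsfun measurableTypeR R >-> R}) :
  (sintegral W h = \int[leb]_x ((h x)%:E * (pdf x)%:E))%E.
Proof.
have mh r : measurable_fun [set: measurableTypeR R]
    (fun x => (r%:E * (\1_(h @^-1` [set r]) x)%:E)%E).
  apply: measurable_funeM; apply/measurable_EFinP; apply: measurable_indic.
  exact: measurable_funPTI.
rewrite sintegralE.
under [RHS]eq_integral => x _.
  rewrite fimfunE -fsumEFin// ge0_mule_fsuml; last first.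
    by move=> r; rewrite EFinM nnfun_muleindic_ge0.
  over.
rewrite ge0_integral_fsum//; last 2 first.
- by move=> r; apply: emeasurable_funM => //; exact: mh.
- by move=> r x _; rewrite mule_ge0// EFinM nnfun_muleindic_ge0.
apply: eq_fsbigr => r rh.
under eq_integral do rewrite EFinM -muleA.
rewrite ge0_integralZl//; last 3 first.
- apply: emeasurable_funM => //.
  by apply/measurable_EFinP; apply: measurable_indic; exact: measurable_funPTI.
- by move=> x _; rewrite mule_ge0// lee_fin.
- by move: rh; rewrite inE => -[x _ <-]; rewrite lee_fin.
congr (_ * _)%E; rewrite /wigner_measure /= /wigner integral_mkcond.
by apply: eq_integral => x _; rewrite epatch_indic/= muleC.
Qed.

(** Increasing simple approximations of [f], with monotone convergence on both sides. *)
Lemma ge0_integral_wigner f : measurable_fun setT f -> (forall x, 0 <= f x) ->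
  (\int[W]_x (f x)%:E = \int[leb]_x (f x * pdf x)%:E)%E.
Proof.
move=> mf f0.
have mf' : measurable_fun [set: measurableTypeR R] (fun x => (f x)%:E).
  exact/measurable_EFinP.
have f0' (x : measurableTypeR R) : (0 <= (f x)%:E)%E by rewrite lee_fin.
pose h := nnsfun_approx measurableT mf'.
have nd_h x : nondecreasing_seq (fun n => h n x).
  by move=> a b ab; exact/lefP/nd_nnsfun_approx.
have hf x : (h n x)%:E @[n --> \oo] --> (f x)%:E.
  by apply: (cvg_nnsfun_approx measurableT mf').
rewrite (nd_ge0_integral_lim W f0' nd_h hf).
under [X in limn X]funext => n do rewrite /= sintegral_wigner.
rewrite -monotone_convergence//=; last 3 first.
- move=> n; apply: emeasurable_funM => //.
  by apply/measurable_EFinP; exact: measurable_funP.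
- by move=> n x _; rewrite mule_ge0// lee_fin.
- by move=> x _ a b ab; rewrite lee_wpmul2r// lee_fin; exact: nd_h.
apply: eq_integral => x _; rewrite EFinM; apply/cvg_lim => //.
by apply: cvgeZr => //; exact: hf.
Qed.

Lemma integral_wigner f : measurable_fun setT f ->
  (\int[W]_x (f x)%:E = \int[leb]_x (f x * pdf x)%:E)%E.
Proof.
move=> mf.
have max_ge0 (r : R) : 0 <= Num.max r 0 by rewrite le_max lexx orbT.
have mpos : measurable_fun setT (fun y : R => Num.max (f y) 0).
  by apply: measurable_maxr => //; exact: measurable_cst.
have mneg : measurable_fun setT (fun y : R => Num.max (- f y) 0).
  apply: measurable_maxr; last exact: measurable_cst.
  exact: measurableT_comp (@oppr_measurable R setT) mf.
rewrite [LHS]integralE [RHS]integralE.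
under eq_integral do rewrite funeposE -EFin_max.
under [X in (_ - X = _)%E]eq_integral do rewrite funenegE -EFinN -EFin_max.
rewrite !ge0_integral_wigner//; congr (_ - _)%E; apply: eq_integral => x _.
  by rewrite funeposE -EFin_max maxr_pMl ?wigner_pdf_ge0// mul0r.
by rewrite funenegE -EFinN -EFin_max -mulNr maxr_pMl ?wigner_pdf_ge0// mul0r.
Qed.

End WignerIntegral.

(** * The substitution x = 2 cos t and the limit of the weighted sums *)

Section Convergence.
Variables (R : realType) (f : R -> R).
Hypothesis cf : continuous f.
Local Notation leb := (@lebesgue_measure R).
Local Notation W := (wigner_measure R).

(** The density enters without its cut-off: [Num.sqrt] is 0 at negative numbers, so [h] is
    continuous on the whole line. *)
Let h (x : R) : R := f x * ((2 * pi)^-1 * Num.sqrt (4 - x ^+ 2)).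
(** Starting at -3 rather than -2 makes [F] differentiable also at the end points of [-2, 2], which
    [2 * cos t] attains. *)
Let F (x : R) : R := (\int[leb]_(t in `[-3, x]) h t)%R.

Let continuous_h : continuous h.
Proof.
move=> x; apply: (@continuousM _ R^o f); first exact: cf.
apply: (@continuousM _ R^o (fun=> (2 * pi)^-1)
  (fun x => Num.sqrt (4 - x ^+ 2))); first exact: cst_continuous.
apply: continuous_comp; last exact: sqrt_continuous.
apply: (@continuousB _ R^o) => //; first exact: cst_continuous.
exact: exprn_continuous.
Qed.

Let is_derive_F (x : R) : -3 < x < 3 -> is_derive x 1 F (h x).
Proof.
move=> /andP[x3 x3'].
have hint : leb.-integrable `[-3, 3] (EFin \o h).
  apply: continuous_compact_integrable; first exact: segment_compact.
  exact: continuous_subspaceT.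
have [dF <-] := continuous_FTC1_closed x3' hint x3 (@continuous_h x).
by rewrite derive1E; exact: derivableP.
Qed.

Lemma integral_wigner_primitive : (\int[W]_x (f x)%:E = (F 2 - F (-2))%:E)%E.
Proof.
rewrite integral_wigner; last exact: continuous_measurable_fun.
transitivity (\int[leb]_(x in `[(-2)%R, 2%R]) (h x)%:E)%E.
  rewrite [RHS]integral_mkcond; apply: eq_integral => x _.
  rewrite /wigner_pdf !patchE /h; case: ifP => _ //=.
  by rewrite mulr0.
have dF (x : R) : -2 <= x <= 2 -> is_derive x 1 F (h x).
  by move=> /andP[? ?]; apply: is_derive_F; lra.
have cF (x : R) : -2 <= x <= 2 -> {for x, continuous F}.
  by move=> /dF/@ex_derive/derivable1_diffP/differentiable_continuous.
rewrite EFinB; apply: continuous_FTC2.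
- by lra.
- exact: continuous_subspaceT.
- split.
  + by move=> x /[!in_itv]/= /andP[? ?]; have /@ex_derive := dF x ltac:(lra).
  + by apply: cvg_at_right_filter; apply: cF; lra.
  + by apply: cvg_at_left_filter; apply: cF; lra.
- move=> x /[!in_itv]/= /andP[? ?]; rewrite derive1E.
  by have /@derive_val := dF x ltac:(lra).
Qed.

(** The integrand after x = 2 cos t. Its primitive [G] carries a minus sign because x decreases as t
    runs from 0 to pi. *)
Let phi (t : R) : R := h (2 * cos t) * (2 * sin t).
Let G (t : R) : R := - F (2 * cos t).

Let is_derive_G (t : R) : is_derive t 1 G (phi t).
Proof.
have d2 : is_derive t 1 (fun s : R => 2 * cos s) (2 * - sin t).
  exact: (@is_deriveZ _ _ _ (cos : R -> R) 2).
have d3 : is_derive (2 * cos t) 1 F (h (2 * cos t)).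
  by apply: is_derive_F; have := cos_geN1 t; have := cos_le1 t; lra.
have /= d4 := @is_derive1_comp R F (fun s => 2 * cos s) t _ _ d3 d2.
rewrite (_ : phi t = - (h (2 * cos t) * (2 * - sin t))); last first.
  by rewrite /phi; ring.
exact: is_deriveN d4.
Qed.

Let continuous_phi : continuous phi.
Proof.
move=> t.
apply: (@continuousM _ R^o (fun t => h (2 * cos t)) (fun t => 2 * sin t)).
  apply: (@continuous_comp _ _ _ (fun t => 2 * cos t) h);
    last exact: continuous_h.
  apply: (@continuousM _ R^o (fun=> 2) cos); first exact: cst_continuous.
  exact: continuous_cos.
apply: (@continuousM _ R^o (fun=> 2) sin); first exact: cst_continuous.
exact: continuous_sin.
Qed.

(** The angle lies in [0, pi], so the square root at x = 2 cos t is 2 sin t, and [phi] becomes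
    (2/pi) sin^2 t f(2 cos t). *)
Let phi_weight m (j : nat) : (j <= m)%N ->
  phi (angle R m j.+1) * (pi / m.+2%:R) = weight R m j * f (atom R m j).
Proof.
move=> jm; have N0 : 0 < m.+2%:R :> R by rewrite ltr0n.
have pi0 := @pi_gt0 R.
rewrite /phi /h /weight /atom; set t := angle _ _ _.
have st : 0 <= sin t.
  apply: sin_ge0_pi; rewrite /t /angle; apply/andP; split.
    by rewrite divr_ge0 ?mulr_ge0 ?ler0n ?ltW.
  by rewrite ler_pdivrMr// ler_pM2l// ler_nat; lia.
have -> : 4 - (2 * cos t) ^+ 2 = (2 * sin t) ^+ 2.
  by rewrite !exprMn sin2cos2; ring.
rewrite sqrtr_sqr ger0_norm; last by rewrite mulr_ge0.
clearbody t; move: (pi : R) pi0 (m.+2%:R : R) N0 => p p0 N N0.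
by field; apply/andP; split; exact: lt0r_neq0.
Qed.

Lemma cvg_weight_sum :
  (\sum_(j < m.+1) weight R m j * f (atom R m j))%:E @[m --> \oo] -->
  (\int[W]_x (f x)%:E)%E.
Proof.
rewrite integral_wigner_primitive; apply: cvg_EFin; first by near=> m.
have -> : F 2 - F (-2) = G pi - G 0.
  by rewrite /G cospi cos0 mulrN1 mulr1 opprK addrC.
have := cvg_riemann_sum (@pi_gt0 R) continuous_phi is_derive_G.
(* The index [m + 1] of the Riemann sum divides [0, pi] into the required [m + 2] cells. *)
rewrite -cvg_shiftS; apply: cvg_trans; apply: near_eq_cvg; near=> m => /=.
(* The last node is pi, where [phi] vanishes; the other [m + 1] nodes are the angles of the
   atoms. *)
rewrite big_ord_recr /= mulfK; last by apply: lt0r_neq0; rewrite ltr0n.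
rewrite {2}/phi sinpi !mulr0 mul0r addr0; apply: eq_bigr => j _.
by rewrite -phi_weight// -ltnS.
Unshelve. all: by end_near. Qed.

End Convergence.

(** * Existence, uniqueness and weak convergence *)

Lemma weight_ge0 (R : realType) m j : 0 <= weight R m j.
Proof. by rewrite /weight mulr_ge0 ?sqr_ge0// divr_ge0. Qed.

Theorem mainTheorem4 (R : realType) :
  (forall m : nat, (0 < m)%N ->
     exists mu : {measure set (measurableTypeR R) -> \bar R},
       has_moments mu (fun n => (Mnum m n)%:R) /\
       (forall nu : {measure set (measurableTypeR R) -> \bar R},
          has_moments nu (fun n => (Mnum m n)%:R) ->
          forall A : set (measurableTypeR R), measurable A -> nu A = mu A)) /\
  (forall mu : nat -> {measure set (measurableTypeR R) -> \bar R},
     (forall m : nat, (0 < m)%N ->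
        has_moments (mu m) (fun n => (Mnum m n)%:R)) ->
     converges_weakly mu (wigner_measure R)).
Proof.
have MnumE m : (fun n => (Mnum m n)%:R) =
    (fun n => \sum_(j < m.+1) weight R m j * atom R m j ^+ n).
  by apply/funext => n; exact: Mnum_sum.
split=> [m _|mu hmu f cf _].
  rewrite MnumE.
  have [mu hmu] := atomic_moments_exist m.+1 (atom R m) (weight_ge0 R m).
  by exists mu; split => // nu hnu; exact: atomic_moments_unique hnu hmu.
(* The moments of [mu m] are prescribed for [m > 0], so the integrals are identified with the
   weighted sums eventually, which suffices for the limit. *)
apply: cvg_trans (cvg_weight_sum cf); apply: near_eq_cvg; near=> m.
have m0 : (0 < m)%N by near: m; exact: nbhs_infty_gt.
have := hmu m m0; rewrite MnumE => /integral_moments_atoms -> //.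
exact: continuous_measurable_fun.
Unshelve. all: by end_near. Qed.
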